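(* Let $n\ge3$. There is a fully pinned configuration $P^\Phi\in\mathcal M_n$ such that $$W(P^\Phi)\cap\{h\otimes u:\ h\in H_0(P^\Phi),\ u\in\mathbb R^2\}=\{0\}.$$
   Context: A configuration is $P=(p_1,\dots,p_n)$ with $p_i=(x_i,y_i)\in[0,1]^2$. For a triple $t=(i,j,k)$, $i<j<k$, put $D_t(P)=\det(p_j-p_i,p_k-p_i)$, $A_t(P)=\tfrac12|D_t(P)|$, $\delta(P)=\min_tA_t(P)$, $\Delta_n=\max_P\delta(P)>0$, and $\mathcal M_n=\{P\in([0,1]^2)^n:\delta(P)=\Delta_n\}$. Fix $P\in\mathcal M_n$. Triangle $t$ is tight if $A_t(P)=\Delta_n$. Put $s_t=\operatorname{sgn}D_t(P)$; near $P$, $A_t=\tfrac12s_tD_t$, which is used for derivatives. Fully pinned: for $i\in[n]$, the one-point feasible polyhedron at $i$ is the set of $(p,\tau)\in\mathbb R^2\times\mathbb R$ such that $p\in[0,1]^2$ and $\tfrac12s_tD_t(P')\ge\tau$ for all triples $t$, where $P'$ is $P$ with $p_i$ replaced by $p$ (signs $s_t$ fixed from $P$). $P$ is fully pinned if $(p_i,\Delta_n)$ is a vertex of its one-point feasible polyhedron for every $i$. A normalized KKT multiplier at $P$ is a tuple $q=(\lambda,\ell,r,d,u)$ of nonnegative reals $\lambda_t$ (all triples $t$), $\ell_i,r_i,d_i,u_i$ ($i\in[n]$) with: $\lambda_t=0$ unless $t$ is tight; $\ell_i=0$ unless $x_i=0$, $r_i=0$ unless $x_i=1$, $d_i=0$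 unless $y_i=0$, $u_i=0$ unless $y_i=1$; $\sum_t\lambda_t=1$; and $\sum_t\lambda_t\nabla_{p_i}A_t(P)+(\ell_i-r_i,d_i-u_i)=0$ for all $i$. Their set is $\mathcal K(P)$. For $t=(i,j,k)$, $i<j<k$, let $B_t=s_t(a_tc_t^T-c_ta_t^T)\in\mathbb R^{n\times n}$, $a_t=e_j-e_i$, $c_t=e_k-e_i$, and $B(q)=\sum_t\lambda_tB_t$. The shared kernel is $K_{\mathrm{sh}}=\bigcap_{q\in\mathcal K(P)}\ker B(q)$; it contains the all-ones vector $\mathbf 1$. Put $H_0=H_0(P)=K_{\mathrm{sh}}/\langle\mathbf 1\rangle$. Velocities are $v=(\xi,\eta)\in\mathbb R^n\oplus\mathbb R^n$, $v_i=(\xi_i,\eta_i)$. $J^{\mathrm{tr}}_{\mathrm{tight}}$ is the linear map with rows: $v\mapsto DA_t(P)[v]$ for all tight $t$; $v\mapsto\xi_i-\xi_j$ for all $i,j$ with $x_i,x_j\in\{0,1\}$; $v\mapsto\eta_i-\eta_j$ for all $i,j$ with $y_i,y_j\in\{0,1\}$. With $T_{\mathrm{tr}}=\operatorname{span}\{(\mathbf 1,0),(0,\mathbf 1)\}$, put $$W(P)=\frac{(K_{\mathrm{sh}}\oplus K_{\mathrm{sh}})\cap\ker J^{\mathrm{tr}}_{\mathrm{tight}}}{T_{\mathrm{tr}}}\subset H_0\oplus H_0=H_0\otimes\mathbb R^2,$$ where $h\otimes u$ corresponds to $(u_1h,u_2h)$, i.e. to the velocity $v_i=h_iu$ modulo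 translations. *)

(* Defs.v *)
From HB Require Import structures.
From mathcomp Require Import all_boot all_order all_algebra.
From mathcomp Require Import all_classical all_reals all_analysis.

Set Implicit Arguments.
Unset Strict Implicit.
Unset Printing Implicit Defensive.

Import Order.TTheory GRing.Theory Num.Theory.
Import numFieldNormedType.Exports.
Local Open Scope classical_set_scope.
Local Open Scope ring_scope.

(* A vertex of a polyhedron S is a zero-dimensional face {w}: some linear
   functional attains its maximum over S at w and nowhere else. *)
Definition is_vertex (R : realType) (V : lmodType R) (S : set V) (w : V) :=
  S w /\ exists f : {scalar V}, forall z, S z -> z <> w -> f z < f w.

(* The quotient of S by a subgroup T, as a set of cosets v + T; the zero of
   the quotient is T itself. *)
Definition qclass (V : zmodType) (T : set V) (v : V) : set V :=
  [set v + t | t in T].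

Definition quot (V : zmodType) (S T : set V) : set (set V) :=
  [set qclass T v | v in S].

Notation triple n :=
  {t : 'I_n * 'I_n * 'I_n | (t.1.1 < t.1.2)%N && (t.1.2 < t.2)%N}.

Section Configurations.
Context {R : realType} {n : nat}.

(* The point p_i = (x_i, y_i) is row i of P; velocities v = (xi, eta) are
   encoded likewise, with xi and eta as columns 0 and 1. *)
Implicit Types (P Q v : 'M[R]_(n, 2)) (t : triple n) (i j : 'I_n).

Definition fst_ix t : 'I_n := (val t).1.1.
Definition snd_ix t : 'I_n := (val t).1.2.
Definition trd_ix t : 'I_n := (val t).2.

Definition config : set 'M[R]_(n, 2) :=
  [set P | forall i k, 0 <= P i k <= 1].

Definition Dt t P : R :=
  \det (col_mx (row (snd_ix t) P - row (fst_ix t) P)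
               (row (trd_ix t) P - row (fst_ix t) P) : 'M[R]_2).

Definition area t P : R := `|Dt t P| / 2.

(* For 3 <= n this is a minimum over a finite nonempty set. *)
Definition min_area P : R := inf (range (area^~ P)).

Definition max_min_area : R := sup (min_area @` config).

Definition maximizers : set 'M[R]_(n, 2) :=
  [set P | config P /\ min_area P = max_min_area].

Definition tight P t := area t P = max_min_area.

Definition sgn_t P t : R := Num.sg (Dt t P).

(* The smooth expression of A_t near P: the sign is frozen at P. *)
Definition sarea P t Q : R := sgn_t P t * Dt t Q / 2.

Definition move_point P i (p : 'rV[R]_2) : 'M[R]_(n, 2) :=
  \matrix_(j < n) (if j == i then p else row j P).

Definition one_point_polyhedron P i : set ('rV[R]_2 * R^o)%type :=
  [set z : ('rV[R]_2 * R^o)%type |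
           (forall k, 0 <= z.1 0 k <= 1) /\
           (forall t, z.2 <= sarea P t (move_point P i z.1))].

Definition fully_pinned P :=
  forall i, is_vertex (one_point_polyhedron P i) (row i P, max_min_area).

Record multiplier := Multiplier {
  mlam : triple n -> R;
  mleft : 'I_n -> R;
  mright : 'I_n -> R;
  mbottom : 'I_n -> R;
  mtop : 'I_n -> R
}.

Definition grad_area P t i : 'rV[R]_2 :=
  \row_k 'D_(delta_mx i k) (sarea P t) P.

Definition box_force (q : multiplier) i : 'rV[R]_2 :=
  row_mx (mleft q i - mright q i)%:M (mbottom q i - mtop q i)%:M.

Definition kkt P (q : multiplier) :=
  [/\ (forall t, 0 <= mlam q t) /\
      (forall i, [/\ 0 <= mleft q i, 0 <= mright q i,
                     0 <= mbottom q i & 0 <= mtop q i]),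
      forall t, ~ tight P t -> mlam q t = 0,
      forall i, [/\ P i 0 <> 0 -> mleft q i = 0,
                    P i 0 <> 1 -> mright q i = 0,
                    P i 1 <> 0 -> mbottom q i = 0
                  & P i 1 <> 1 -> mtop q i = 0],
      \sum_t mlam q t = 1
    & forall i, \sum_t mlam q t *: grad_area P t i + box_force q i = 0].

Definition avec t : 'cV[R]_n := delta_mx (snd_ix t) 0 - delta_mx (fst_ix t) 0.
Definition cvec t : 'cV[R]_n := delta_mx (trd_ix t) 0 - delta_mx (fst_ix t) 0.

Definition Bt P t : 'M[R]_n :=
  sgn_t P t *: (avec t *m (cvec t)^T - cvec t *m (avec t)^T).

Definition Bq P (q : multiplier) : 'M[R]_n := \sum_t mlam q t *: Bt P t.

Definition Ksh P : set 'cV[R]_n :=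
  [set h | forall q, kkt P q -> Bq P q *m h = 0].

Definition ones_line : set 'cV[R]_n := range (fun c : R => const_mx c).

Definition H0 P : set (set 'cV[R]_n) := quot (Ksh P) ones_line.

Definition Ttr : set 'M[R]_(n, 2) :=
  range (fun c : 'rV[R]_2 => (const_mx 1 : 'cV[R]_n) *m c).

Definition KshKsh P : set 'M[R]_(n, 2) :=
  [set v | Ksh P (col 0 v) /\ Ksh P (col 1 v)].

Definition kerJ P : set 'M[R]_(n, 2) :=
  [set v | [/\ forall t, tight P t -> 'D_v (sarea P t) P = 0,
               forall i j, (P i 0 = 0 \/ P i 0 = 1) ->
                 (P j 0 = 0 \/ P j 0 = 1) -> v i 0 - v j 0 = 0
             & forall i j, (P i 1 = 0 \/ P i 1 = 1) ->
                 (P j 1 = 0 \/ P j 1 = 1) -> v i 1 - v j 1 = 0]].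

Definition W P : set (set 'M[R]_(n, 2)) := quot (KshKsh P `&` kerJ P) Ttr.

(* X (x) u for a class X in H0: the class modulo Ttr of the velocity
   v_i = h_i u (the matrix h *m u), for any representative h of X. *)
Definition tens (X : set 'cV[R]_n) (u : 'rV[R]_2) : set 'M[R]_(n, 2) :=
  [set h *m u + w | h in X & w in Ttr].

End Configurations.

Arguments config : clear implicits.
Arguments maximizers : clear implicits.
Arguments Ttr : clear implicits.

(* Main.v *)
(* Among the maximizers, which form a compact set, choose one of largest total
   squared distance to the origin: by the parallelogram law it is not the midpoint
   of a nontrivial segment of maximizers.
   A one-point feasible polyhedron lies below height Delta_n, and its points at
   that height are maximizers; so (p_i, Delta_n) is an extreme point of it,
   hence a vertex.
   If h (x) u is in W(P), then v = h (x) u has rank one, so every D_t is affine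
   along P + s v and the tight areas are constant there; after a translation
   fixing the boundary contacts, P + s v is a maximizer for all small s of
   either sign, hence v is a translation. *)
Require Import Defs.
From HB Require Import structures.
From mathcomp Require Import all_boot all_order all_algebra.
From mathcomp Require Import all_classical all_reals all_analysis.
From mathcomp Require Import ring lra.
Import Order.TTheory GRing.Theory Num.Theory.
Import numFieldNormedType.Exports.
Local Open Scope classical_set_scope.
Local Open Scope ring_scope.

Set Implicit Arguments.
Unset Strict Implicit.
Unset Printing Implicit Defensive.

(** * Extreme points and vertices of polyhedra *)

(** Read [a] as the slacks of finitely many constraints and [b] as their rates of change: if no
    active constraint moves, a step of size at most [e] in either direction violates none. The least
    ratio of slack to rate, capped at 1, serves as [e]. *)
Lemma exists_slack_scale (R : realFieldType) (C : finType) (a b : C -> R) :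
  (forall c, 0 <= a c) -> (forall c, a c = 0 -> b c = 0) ->
  exists2 e, 0 < e & forall c, e * `|b c| <= a c.
Proof.
move=> a0 ab; pose r c := if b c == 0 then 1 else a c / `|b c|.
exists (\big[Num.min/1]_c r c).
  apply: lt_bigmin => // c _; rewrite /r; case: ifPn => // b0.
  rewrite divr_gt0 ?normr_gt0// lt_def a0 andbT.
  by apply: contra b0 => /eqP /ab ->.
move=> c; have [->|b0] := eqVneq (b c) 0; first by rewrite normr0 mulr0.
rewrite -ler_pdivlMr ?normr_gt0//.
by have := bigmin_le_cond 1 r (isT : xpredT c); rewrite {2}/r (negPf b0).
Qed.

Lemma polyhedron_extreme_vertex (R : realType) (V : lmodType R) (C : finType)
    (l : C -> V -> R) (b : C -> R) (S : set V) (w : V) :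
  (forall c, scalar (l c)) ->
  S = [set z | forall c, 0 <= l c z + b c] ->
  S w -> (forall d, S (w + d) -> S (w - d) -> d = 0) -> is_vertex S w.
Proof.
move=> ll SE Sw ext; split=> //.
have lD c x y : l c (x + y) = l c x + l c y.
  by have := ll c 1 x y; rewrite scale1r mul1r.
have l0 c : l c 0 = 0 by apply: (addrI (l c 0)); rewrite -lD !addr0.
have lZ c s x : l c (s *: x) = s * l c x.
  by have := ll c s x 0; rewrite !addr0 l0 addr0.
have lN c x : l c (- x) = - l c x by rewrite -scaleN1r lZ mulN1r.
(* The normals of the constraints active at [w] add up to a functional whose
   minimum over [S] is attained exactly where they are all active. *)
pose A := [pred c | l c w + b c == 0].
pose f z := - \sum_(c | A c) l c z.
have fl : scalar f.
  move=> s x y; rewrite /f mulrN -opprD mulr_sumr -big_split /=.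
  by congr (- _); apply: eq_bigr => c _; rewrite ll.
pose F : {scalar V} := HB.pack f (GRing.isLinear.Build R V R *%R f fl).
exists F => z Sz zw; rewrite /F /= /f ltrN2 -subr_gt0 -sumrB lt_def.
have Aw c : A c -> l c w = - b c by move=> /eqP /(canRL (addrK _)); rewrite sub0r.
have zP c : A c -> 0 <= l c z - l c w.
  by move=> Ac; rewrite Aw// opprK; move: Sz; rewrite SE; apply.
rewrite sumr_ge0// andbT; apply/eqP => /psumr_eq0P => /(_ zP) z0.
have lw0 c : 0 <= l c w + b c by move: Sw; rewrite SE; apply.
have tight0 c : l c w + b c = 0 -> l c (z - w) = 0.
  by move=> /eqP cA; rewrite lD lN z0.
(* All constraints active at [w] are constant along [z - w], so [w] can move a little both ways on
   this line inside [S]; extremality then forces [z = w]. *)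
have [e e0 eP] := exists_slack_scale lw0 tight0.
have dP s : `|s| <= e -> S (w + s *: (z - w)).
  move=> se; rewrite SE => c /=; rewrite lD lZ addrAC.
  have : `|s * l c (z - w)| <= l c w + b c.
    by rewrite normrM; apply: le_trans (eP c); rewrite ler_wpM2r.
  by rewrite ler_norml -subr_ge0 opprK addrC => /andP[].
have : e *: (z - w) = 0.
  apply: ext; first by apply: dP; rewrite gtr0_norm.
  by rewrite -scaleNr; apply: dP; rewrite normrN gtr0_norm.
by move/eqP; rewrite scaler_eq0 gt_eqF//= subr_eq0 => /eqP.
Qed.

(** * Triangle areas and compactness of the maximizers *)

Section Areas.
Context {R : realType} {n : nat}.
Implicit Types (P Q v : 'M[R]_(n, 2)) (t : triple n).

Local Notation Delta := (@max_min_area R n).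

Lemma DtE t Q :
  Dt t Q = (Q (snd_ix t) 0 - Q (fst_ix t) 0) * (Q (trd_ix t) 1 - Q (fst_ix t) 1)
         - (Q (snd_ix t) 1 - Q (fst_ix t) 1) * (Q (trd_ix t) 0 - Q (fst_ix t) 0).
Proof.
rewrite /Dt (expand_det_row _ 0) !big_ord_recl big_ord0 /cofactor !det_mx11 !mxE.
have -> : lift 0 0 = 1 :> 'I_2 by exact/val_inj.
have -> : lift 1 0 = 0 :> 'I_2 by exact/val_inj.
have -> : fintype.split (0 : 'I_(1 + 1)) = inl 0.
  by rewrite -[RHS]unsplitK; congr fintype.split; exact/val_inj.
have -> : fintype.split (1 : 'I_(1 + 1)) = inr 0.
  by rewrite -[RHS]unsplitK; congr fintype.split; exact/val_inj.
by rewrite !mxE /=; ring.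
Qed.

Lemma sarea_le_area P t Q : sarea P t Q <= area t Q.
Proof.
rewrite /sarea /area ler_pM2r ?invr_gt0// (le_trans (ler_norm _))//.
by rewrite normrM ler_piMl// /sgn_t normr_sg lern1 leq_b1.
Qed.

Lemma sarea_self P t : sarea P t P = area t P.
Proof. by rewrite /sarea /area normrEsg. Qed.

Lemma min_area_le t Q : min_area Q <= area t Q.
Proof.
apply: ge_inf; last by exists t.
by exists 0 => _ [s _ <-]; rewrite divr_ge0.
Qed.

(** The witness [t0] makes the range nonempty, so that [inf] is a genuine infimum. *)
Lemma le_min_area (t0 : triple n) c Q :
  (forall t, c <= area t Q) -> c <= min_area Q.
Proof.
move=> cA; apply: lb_le_inf; first by exists (area t0 Q), t0.
by move=> _ [s _ <-].
Qed.

Lemma continuous_area t : continuous (area t : 'M[R]_(n, 2) -> R).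
Proof.
rewrite (_ : area t = fun Q => `|Dt t Q| / 2)//.
under eq_fun do rewrite DtE.
move=> Q; apply: (@cvgM _ _ (nbhs Q)); last exact: cvg_cst.
by apply: cvg_norm; apply: (@cvgB _ _ _ (nbhs Q)); apply: (@cvgM _ _ (nbhs Q));
  apply: (@cvgB _ _ _ (nbhs Q)); exact: coord_continuous.
Qed.

Lemma min_areaE (t0 : triple n) Q :
  min_area Q = \big[Num.min/area t0 Q]_t area t Q.
Proof.
apply/le_anti/andP; split.
  by apply: le_bigmin => [|t _]; exact: min_area_le.
by apply: (le_min_area t0) => t; exact: bigmin_le_cond.
Qed.

Lemma continuous_min_area (t0 : triple n) :
  continuous (min_area : 'M[R]_(n, 2) -> R).
Proof.
(* An arbitrary list of triples, with [area t0] as start value, permits induction on the list. *)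
pose F (r : seq (triple n)) (Q : 'M[R]_(n, 2)) : R^o :=
  \big[Num.min/area t0 Q]_(t <- r) area t Q.
have -> : min_area = F (index_enum _).
  by apply/funext => Q; exact: min_areaE.
elim: (index_enum _) => [|t r cr] Q.
  have -> : F [::] = area t0 by apply/funext => ?; rewrite /F big_nil.
  exact: continuous_area.
have -> : F (t :: r) = area t \min F r by apply/funext => ?; rewrite /F big_cons.
by apply: continuous_min; [exact: continuous_area|exact: cr].
Qed.

Lemma continuous_vec_mx m k : continuous (vec_mx : 'rV[R]_(m * k) -> 'M[R]_(m, k)).
Proof.
move=> v A [B vB BA].
suff : \forall w \near v, forall i j, B i j (vec_mx w i j).
  by apply: filterS => w wB; exact: BA.
apply: (@filter_forall _ _ _ (nbhs v)) => i.
apply: (@filter_forall _ _ _ (nbhs v)) => j.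
have := vB i j; rewrite mxE => vBij.
under eq_near do rewrite mxE.
exact: (coord_continuous vBij).
Qed.

(** A product of segments is compact as a set of row vectors, and the continuous [vec_mx] maps it
    onto the configurations. *)
Lemma compact_config : compact (config R n).
Proof.
pose B := [set v : 'rV[R]_(n * 2) | forall i, `[0, 1]%classic (v ord0 i)].
have -> : config R n = vec_mx @` B.
  apply/seteqP; split=> [Q Qc|_ [v vB <-] i k]; last first.
    by rewrite mxE; have := vB (mxvec_index i k); rewrite /= in_itv.
  exists (mxvec Q); last exact: mxvecK.
  by move=> j; case/mxvec_indexP: j => i k; rewrite mxvecE /= in_itv /=; exact: Qc.
apply: continuous_compact; last first.
  exact: (@rV_compact R _ (fun=> `[0, 1]%classic) (fun=> @segment_compact R 0 1)).
exact/continuous_subspaceT/continuous_vec_mx.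
Qed.

Lemma config_neq0 : config R n !=set0.
Proof. by exists 0 => i k; rewrite mxE lexx ler01. Qed.

Lemma min_area_max (t0 : triple n) :
  exists2 P, config R n P & forall Q, config R n Q -> min_area Q <= min_area P.
Proof.
have [P /set_mem Pc Pmax] := compact_EVT_max config_neq0 compact_config
  (continuous_subspaceT (continuous_min_area t0)).
by exists P => // Q Qc; apply: Pmax; exact: mem_set.
Qed.

Lemma min_area_le_max (t0 : triple n) Q :
  config R n Q -> min_area Q <= Delta.
Proof.
move=> Qc; have [P Pc Pmax] := min_area_max t0.
apply: ub_le_sup; last by exists Q.
by exists (min_area P) => _ [S Sc <-]; exact: Pmax.
Qed.

Lemma maximizersP (t0 : triple n) Q :
  maximizers R n Q <-> config R n Q /\ forall t, Delta <= area t Q.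
Proof.
split=> [[Qc QD]|[Qc QA]]; split=> //; first by move=> t; rewrite -QD min_area_le.
apply/le_anti; rewrite (min_area_le_max t0)//=.
exact: (le_min_area t0).
Qed.

Lemma maximizers_neq0 (t0 : triple n) : maximizers R n !=set0.
Proof.
have [P Pc Pmax] := min_area_max t0; exists P; split=> //.
apply/le_anti; rewrite (min_area_le_max t0)//=.
by apply: ge_sup => [|_ [Q Qc <-]]; [exists (min_area P), P|exact: Pmax].
Qed.

Lemma compact_maximizers (t0 : triple n) : compact (maximizers R n).
Proof.
have -> : maximizers R n = config R n `&` (min_area @^-1` [set Delta]).
  by [].
apply: compact_closedI; first exact: compact_config.
apply: preimage_closed; last exact: closed_eq.
by move=> Q _; exact: continuous_min_area.
Qed.

(** * An extreme point of the set of maximizers *)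

Definition sumsq Q : R := \sum_i \sum_k Q i k ^+ 2.

Lemma continuous_sumsq : continuous (sumsq : 'M[R]_(n, 2) -> R).
Proof.
rewrite /sumsq; apply: continuous_big => [|i _]; first exact: add_continuous.
apply: continuous_big => [|k _]; first exact: add_continuous.
by move=> Q; apply: (@cvgM _ _ (nbhs Q)); exact: coord_continuous.
Qed.

(** Only the two endpoints have to be maximizers, so the notion makes sense although [maximizers]
    need not be convex. *)
Definition extreme_maximizer P := forall d,
  maximizers R n (P + d) -> maximizers R n (P - d) -> d = 0.

Lemma exists_extreme_maximizer (t0 : triple n) :
  exists2 P, maximizers R n P & extreme_maximizer P.
Proof.
have [P /set_mem PM Pmax] := compact_EVT_max (maximizers_neq0 t0)
  (compact_maximizers t0) (continuous_subspaceT continuous_sumsq).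
exists P => // d /mem_set/Pmax Pd /mem_set/Pmax Nd.
have E : sumsq (P + d) + sumsq (P - d) = sumsq P + sumsq P + (sumsq d + sumsq d).
  rewrite /sumsq -!big_split /=; apply: eq_bigr => i _.
  by rewrite -!big_split /=; apply: eq_bigr => k _; rewrite !mxE; ring.
have d0 : sumsq d <= 0 by lra.
have s0 i : 0 <= \sum_k d i k ^+ 2 by apply: sumr_ge0 => k _; exact: sqr_ge0.
have /psumr_eq0P/= d1 : sumsq d = 0 by apply/le_anti; rewrite d0 sumr_ge0.
apply/matrixP => i k; rewrite mxE; apply/eqP; rewrite -sqrf_eq0; apply/eqP.
by move: k isT; apply: psumr_eq0P; [move=> k _; exact: sqr_ge0|exact: d1].
Qed.

(** * One-point polyhedra and pinning *)

Lemma ord_triple t : (fst_ix t < snd_ix t)%N /\ (snd_ix t < trd_ix t)%N.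
Proof. by apply/andP; exact: (valP t). Qed.

Lemma move_pointE P i p j k :
  move_point P i p j k = if j == i then p 0 k else P j k.
Proof. by rewrite mxE; case: ifP => // _; rewrite mxE. Qed.

(** The indices of a triple are distinct, so [p] is at most one of its vertices and the determinant
    is affine in [p]; subtracting the value at 0 leaves the linear part. *)
Lemma sarea_move_point_scalar P t i :
  scalar (fun p => sarea P t (move_point P i p) - sarea P t (move_point P i 0)).
Proof.
move=> a p q; rewrite /sarea !DtE !move_pointE.
have [fs st] := ord_triple t; move: fs st (ltn_trans fs st).
by case: eqVneq => [->|_]; case: eqVneq => [->|_]; case: eqVneq => [->|_];
  rewrite ?ltnn// => _ _ _; rewrite ?mxE /GRing.scale /=; ring.
Qed.

Lemma le_Delta (t0 : triple n) P Q c :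
  config R n Q -> (forall t, c <= sarea P t Q) -> c <= Delta.
Proof.
move=> Qc cQ; apply: le_trans (min_area_le_max t0 Qc); apply: (le_min_area t0).
by move=> t; exact: le_trans (cQ t) (sarea_le_area P t Q).
Qed.

Lemma sarea_maximizers (t0 : triple n) P Q :
  config R n Q -> (forall t, Delta <= sarea P t Q) -> maximizers R n Q.
Proof.
move=> Qc DQ; apply/(maximizersP t0); split=> // t.
exact: le_trans (DQ t) (sarea_le_area P t Q).
Qed.

Lemma extreme_maximizer_pinned (t0 : triple n) P :
  maximizers R n P -> extreme_maximizer P -> fully_pinned P.
Proof.
move=> PM ext i.
have [Pc PA] := (maximizersP t0 P).1 PM.
(* The constraints are split into linear parts [l] and constants [b]: [inl] holds the sides of the
   square, with [true] for the upper bound, and [inr] the areas. *)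
pose C := ('I_2 * bool + triple n)%type.
pose l (c : C) (z : 'rV[R]_2 * R^o) : R := match c with
  | inl (k, b) => if b then - z.1 0 k else z.1 0 k
  | inr t => sarea P t (move_point P i z.1) - sarea P t (move_point P i 0) - z.2
  end.
pose b (c : C) : R := match c with
  | inl (k, b) => if b then 1 else 0
  | inr t => sarea P t (move_point P i 0)
  end.
apply: (@polyhedron_extreme_vertex _ _ C l b).
- move=> [[k []]|t] a x y /=.
  + by rewrite !mxE; ring.
  + by rewrite !mxE.
  + have /= -> := sarea_move_point_scalar P t i a x.1 y.1.
    by rewrite /GRing.scale /=; ring.
- apply/seteqP; split=> z /=.
    move=> [z1 z2] [[k bb]|t] /=; last by rewrite addrAC subrK subr_ge0.
    by have /andP[] := z1 k; case: bb => /=; lra.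
  move=> zc; split=> [k|t]; last first.
    by have := zc (inr t); rewrite /= addrAC subrK subr_ge0.
  have := zc (inl (k, true)); have := zc (inl (k, false)).
  by rewrite /= addr0 => -> /=; lra.
- split=> [k|t] /=; first by rewrite mxE; exact: Pc.
  rewrite (_ : move_point P i (row i P) = P) ?sarea_self//.
  by apply/matrixP => j k; rewrite move_pointE; case: eqP => // ->; rewrite mxE.
- move=> [p s] [Pp Ap] [Np An]; rewrite /= in Pp Ap Np An.
  pose d : 'M[R]_(n, 2) := \matrix_(j, k) if j == i then p 0 k else 0.
  have PdE : move_point P i (row i P + p) = P + d.
    apply/matrixP => j k; rewrite move_pointE !mxE.
    by case: eqP => [->|] //; rewrite addr0.
  have NdE : move_point P i (row i P - p) = P - d.
    apply/matrixP => j k; rewrite move_pointE !mxE.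
    by case: eqP => [->|] //; rewrite subr0.
  have Pdc : config R n (P + d).
    move=> j k; rewrite -PdE move_pointE.
    by case: eqP => // _; exact: Pc.
  have Ndc : config R n (P - d).
    move=> j k; rewrite -NdE move_pointE.
    by case: eqP => // _; exact: Pc.
  rewrite PdE in Ap; rewrite NdE in An.
  (* The two points have heights [Delta + s] and [Delta - s], neither of which can exceed
     [Delta]. *)
  have s_le0 := le_Delta t0 Pdc Ap; have s_ge0 := le_Delta t0 Ndc An.
  rewrite gerDl in s_le0; rewrite gerBl in s_ge0.
  have s0 : s = 0 by apply/le_anti; rewrite s_le0.
  rewrite s0 ?addr0 ?subr0 in Ap An *.
  have d0 : d = 0.
    by apply: ext; [exact: (sarea_maximizers t0 Pdc Ap)|
                    exact: (sarea_maximizers t0 Ndc An)].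
  congr pair; apply/rowP => k; move/matrixP/(_ i k): d0.
  by rewrite !mxE eqxx.
Qed.

(** * Rank-one motions of an extreme maximizer *)

(* The second-order term of [Dt t] along [v] is [Dt t v]. *)
Lemma sarea_line P t v (s : R) : Dt t v = 0 ->
  sarea P t (s *: v + P) = sarea P t P + s * 'D_v (sarea P t) P.
Proof.
move=> v0.
pose L := sgn_t P t *
  ((P (snd_ix t) 0 - P (fst_ix t) 0) * (v (trd_ix t) 1 - v (fst_ix t) 1) +
   (v (snd_ix t) 0 - v (fst_ix t) 0) * (P (trd_ix t) 1 - P (fst_ix t) 1) -
   (P (snd_ix t) 1 - P (fst_ix t) 1) * (v (trd_ix t) 0 - v (fst_ix t) 0) -
   (v (snd_ix t) 1 - v (fst_ix t) 1) * (P (trd_ix t) 0 - P (fst_ix t) 0)) / 2.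
have LE r : sarea P t (r *: v + P) = sarea P t P + r * L.
  have : sgn_t P t * r ^+ 2 * Dt t v / 2 = 0 by rewrite v0 mulr0 mul0r.
  rewrite /sarea /L !DtE !mxE => E.
  by rewrite -[RHS]addr0 -E; ring.
have -> : 'D_v (sarea P t) P = L; last exact: LE.
(* For nonzero [r] the difference quotient equals [L] exactly. *)
apply: lim_near_cst; first exact: norm_hausdorff.
near=> r; rewrite /= LE addrAC subrr add0r /GRing.scale /= mulKf//.
by near: r; exact: nbhs_dnbhs_neq.
Unshelve. all: by end_near. Qed.

(** The translation cancels in differences, and both edge vectors are then multiples of [u]. *)
Lemma Dt_rank1_translation t (h : 'cV[R]_n) (u c : 'rV[R]_2) :
  Dt t (h *m u + const_mx 1 *m c) = 0.
Proof. by rewrite DtE !mxE !big_ord1 !mxE; ring. Qed.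

Lemma DtD_translation t Q (c : 'rV[R]_2) : Dt t (Q + const_mx 1 *m c) = Dt t Q.
Proof. by rewrite !DtE !mxE !big_ord1 !mxE; ring. Qed.

(** Subtracting this translation freezes every coordinate in contact with the boundary, so that
    small motions stay in the square. *)
Lemma kerJ_boundary_translation P v : kerJ P v ->
  exists c : 'rV[R]_2, forall i k, P i k = 0 \/ P i k = 1 -> v i k = c 0 k.
Proof.
move=> [_ v0 v1].
have vk k i j : P i k = 0 \/ P i k = 1 -> P j k = 0 \/ P j k = 1 -> v i k = v j k.
  move=> Pi Pj; apply/eqP; rewrite -subr_eq0; apply/eqP; move: Pi Pj.
  have [->|->] : k = 0 \/ k = 1; [|exact: v0|exact: v1].
  by case: k => -[|[|//]] k2; [left|right]; exact/val_inj.
have ck k : exists c, forall i, P i k = 0 \/ P i k = 1 -> v i k = c.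
  have [[i Pi]|nP] := pselect (exists i, P i k = 0 \/ P i k = 1).
    by exists (v i k) => j Pj; exact: vk.
  (* Without contacts on this axis any value will do. *)
  by exists 0 => i Pi; case: nP; exists i.
have [c cP] := choice ck.
by exists (\row_k c k) => i k; rewrite mxE; exact: cP.
Qed.

(** The summand with [c] is present because a representative of a class in [W P] equals [h *m u]
    only up to translation. *)
Lemma kerJ_rank1_trivial (t0 : triple n) P (h : 'cV[R]_n) (u c : 'rV[R]_2) :
  maximizers R n P -> extreme_maximizer P ->
  kerJ P (h *m u + const_mx 1 *m c) -> Ttr R n (h *m u + const_mx 1 *m c).
Proof.
move=> PM ext; set v := h *m u + _ => vJ.
have [Pc PA] := (maximizersP t0 P).1 PM.
have [c' c'P] := kerJ_boundary_translation vJ.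
pose w := v - const_mx 1 *m c'.
have wE i k : w i k = v i k - c' 0 k.
  by rewrite mxE; congr (_ + _); rewrite !mxE big_ord1 mxE mul1r.
suff /eqP : w = 0 by rewrite subr_eq0 => /eqP ->; exists c'.
(* Translations preserve areas, so [w] changes them as [v] does, without second-order term. *)
have w_line t s : sarea P t (P + s *: w) = area t P + s * 'D_v (sarea P t) P.
  rewrite -sarea_self -sarea_line ?Dt_rank1_translation//.
  rewrite /sarea -(DtD_translation t (s *: v + P) (- (s *: c'))).
  congr (_ * Dt t _ / _); rewrite /w scalerBr mulmxN -scalemxAr.
  by rewrite addrC addrAC.
pose C := ('I_n * 'I_2 * bool + triple n)%type.
(* Slacks and rates along [w]: at zero slack the rate vanishes, by the choice of [c'] for contacts
   and by [kerJ] for tight triples. *)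
pose a (x : C) : R := match x with
  | inl (i, k, b) => if b then 1 - P i k else P i k
  | inr t => area t P - Delta
  end.
pose b (x : C) : R := match x with
  | inl (i, k, b) => w i k
  | inr t => 'D_v (sarea P t) P
  end.
have a0 x : 0 <= a x.
  case: x => [[[i k] []]|t] /=; rewrite ?subr_ge0//; by case/andP: (Pc i k).
have ab x : a x = 0 -> b x = 0.
  case: x => [[[i k] bb]|t] /= aE.
    rewrite wE c'P ?subrr//; case: bb aE; last by left.
    by move/eqP; rewrite subr_eq0 => /eqP; right.
  by have [+ _ _] := vJ; apply; apply/eqP; rewrite -subr_eq0; exact/eqP.
have [e e0 eP] := exists_slack_scale a0 ab.
have move_max s : `|s| <= e -> maximizers R n (P + s *: w).
  move=> se.
  have sP x : `|s * b x| <= a x.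
    by rewrite normrM; apply: le_trans (eP x); rewrite ler_wpM2r.
  apply: (sarea_maximizers t0 (P := P)) => [i k|t].
    rewrite mxE [X in _ + X]mxE.
    have := sP (inl (i, k, false)); have := sP (inl (i, k, true)).
    by rewrite /= !ler_norml => /andP[] ? ? /andP[] ? ?; lra.
  rewrite w_line; have := sP (inr t); rewrite /= ler_norml => /andP[] ? ?; lra.
have : e *: w = 0.
  apply: ext; first by apply: move_max; rewrite gtr0_norm.
  by rewrite -scaleNr; apply: move_max; rewrite normrN gtr0_norm.
by move/eqP; rewrite scaler_eq0 gt_eqF//= => /eqP.
Qed.

End Areas.

(** * Passage to the quotients *)

Theorem theorem6p4 (R : realType) (n : nat) (hn : (3 <= n)%N) :
  exists P : 'M[R]_(n, 2),
    [/\ maximizers R n P,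
        fully_pinned P
      & W P `&` [set tens X u | X in H0 P & u in [set: 'rV[R]_2]]
        = [set Ttr R n]].
Proof.
have t0 : triple n.
  exists (Ordinal (ltnW (ltnW hn)), Ordinal (ltnW hn), Ordinal hn).
  by [].
have [P PM ext] := @exists_extreme_maximizer R n t0.
exists P; split=> //; first exact: (extreme_maximizer_pinned t0 PM ext).
have Ttr0 : Ttr R n 0 by exists 0 => //; rewrite mulmx0.
apply/seteqP; split=> [X [[v [_ vJ] <-] [_ [h _ <-] [u _ E]]]|_ ->].
(* The common class contains both [v] and [h *m u], which therefore differ by a translation. *)
- have [t [c _ ct] vE] : qclass (Ttr R n) v (h *m u).
    rewrite -E; exists (h + 0); first by exists 0 => //; exists 0 => //; exact: const_mx0.
    by exists 0; rewrite ?addr0.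
  have vr : v = h *m u + const_mx 1 *m (- c) by rewrite -vE -ct mulmxN addrK.
  rewrite vr in vJ *.
  have [d _ <-] := kerJ_rank1_trivial t0 PM ext vJ.
  apply/seteqP; split=> [_ [_ [x _ <-] <-]|_ [x _ <-]].
    by exists (d + x) => //; rewrite mulmxDr.
  by exists (const_mx 1 *m (x - d)); [exists (x - d)|rewrite -mulmxDr addrC subrK].
(* Conversely, [Ttr] is the class of the zero velocity in [W P], and also the tensor of the zero
   class with the zero vector. *)
- have K0 : Ksh P 0 by move=> q _; rewrite mulmx0.
  split.
    exists 0.
      split; first by split; rewrite /= linear0.
      by split=> [t _|i j _ _|i j _ _]; rewrite ?derive0// !mxE subrr.
    apply/seteqP; split=> [_ [x ? <-]|x ?]; first by rewrite add0r.
    by exists x; rewrite ?add0r.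
  exists (qclass (@ones_line R n) 0); first by exists 0.
  exists 0 => //; apply/seteqP; split=> [_ [h _ [x ? <-]]|x ?].
    by rewrite mulmx0 add0r.
  exists 0; last by exists x; rewrite ?mulmx0 ?add0r.
  by exists 0; rewrite ?add0r//; exists 0 => //; exact: const_mx0.
Qed.
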